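(* Let $P$ be a finite poset, let $\alpha,\beta:P\to\mathbb{R}$ be order-decreasing, and let $A,B\in\mathbb{C}^{P\times P}$ be Hermitian with spectral decompositions $$A=\sum_{i\in P}\alpha(i)|a_i\rangle\langle a_i|,\qquad B=\sum_{j\in P}\beta(j)|b_j\rangle\langle b_j|$$ in orthonormal bases $(a_i)_{i\in P}$, $(b_j)_{j\in P}$. Suppose that the change-of-basis matrix $C$ with entries $C_{ij}:=\langle a_i,b_j\rangle$ satisfies $C\in\overline{\mathcal{L}(P)\,\mathcal{U}(P)}$. Then $$\mathrm{tr}[AB]\le\sum_{x\in P}\alpha(x)\beta(x).$$ More generally, if $f,g:I\to\mathbb{R}$ are nondecreasing on an interval $I\subseteq\mathbb{R}$ containing the spectra of $A$ and $B$, then $$\mathrm{tr}[f(A)g(B)]\le\sum_{x\in P}f\big(\alpha(x)\big)\,g\big(\beta(x)\big).$$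
   Context: Matrices in $\mathbb{C}^{P\times P}$ have rows and columns indexed by the finite set $P$. A function $f:P\to\mathbb{R}$ on a poset is order-decreasing if $x\le y$ implies $f(x)\ge f(y)$. For a finite poset $P$, $$\mathcal{L}(P):=\{L\in\mathbb{C}^{P\times P}\mid L_{xy}=0\text{ unless }y\le x\},\qquad \mathcal{U}(P):=\{U\in\mathbb{C}^{P\times P}\mid U_{xy}=0\text{ unless }x\le y\},$$ $\mathcal{L}(P)\,\mathcal{U}(P)=\{LU\mid L\in\mathcal{L}(P),U\in\mathcal{U}(P)\}$, and the bar denotes the closure in the norm topology. $f(A)$ and $g(B)$ are defined by the functional calculus for Hermitian matrices. *)

(* Defs.v *)
From HB Require Import structures.
From mathcomp Require Import all_boot all_order all_algebra.
From mathcomp Require Import sesquilinear spectral complex.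
From mathcomp Require Import all_classical all_reals all_analysis.

Set Implicit Arguments.
Unset Strict Implicit.
Unset Printing Implicit Defensive.

Import Order.TTheory GRing.Theory Num.Theory.
Import numFieldNormedType.Exports.

Local Open Scope classical_set_scope.
Local Open Scope ring_scope.
Local Open Scope complex_scope.
Local Open Scope sesquilinear_scope.

(* [R[i]] is a concrete [numClosedFieldType], so the topology of [R[i]^o] (the
   one of the modulus) has to be transported to it explicitly; ['M[R[i]]_n] then
   carries the corresponding sup-norm structure from the library. *)
HB.instance Definition _ (R : realType) := PseudoPointedMetric.copy R[i] R[i]^o.
HB.instance Definition _ (R : realType) := NormedModule.copy R[i] R[i]^o.

(* Matrices with rows and columns indexed by a finite type [P] are matrices of
   size [#|P|], the entry at [x, y : P] being the one at
   [enum_rank x, enum_rank y]. *)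

Definition lower_mx (R : realType) (d : Order.disp_t) (P : finPOrderType d) :
    set 'M[R[i]]_#|P| :=
  [set L | forall x y : P, ~~ (y <= x)%O -> L (enum_rank x) (enum_rank y) = 0].

Definition upper_mx (R : realType) (d : Order.disp_t) (P : finPOrderType d) :
    set 'M[R[i]]_#|P| :=
  [set U | forall x y : P, ~~ (x <= y)%O -> U (enum_rank x) (enum_rank y) = 0].

Definition lower_upper_mx (R : realType) (d : Order.disp_t)
    (P : finPOrderType d) : set 'M[R[i]]_#|P| :=
  [set L *m U | L in @lower_mx R d P & U in @upper_mx R d P].

Definition order_decreasing (R : realType) (d : Order.disp_t)
    (P : finPOrderType d) (h : P -> R) : Prop :=
  forall x y : P, (x <= y)%O -> h y <= h x.

(* Antilinear in the first argument. *)
Definition braket (R : realType) (n : nat) (u v : 'cV[R[i]]_n) : R[i] :=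
  (u^t* *m v) 0 0.

Definition ketbra (R : realType) (n : nat) (u : 'cV[R[i]]_n) : 'M[R[i]]_n :=
  u *m u^t*.

(* An orthonormal family indexed by [P] in a space of dimension [#|P|] is a
   basis. *)
Definition orthonormal_basis (R : realType) (P : finType)
    (a : P -> 'cV[R[i]]_#|P|) : Prop :=
  forall i j : P, braket (a i) (a j) = (i == j)%:R.

Definition change_of_basis (R : realType) (P : finType)
    (a b : P -> 'cV[R[i]]_#|P|) : 'M[R[i]]_#|P| :=
  \matrix_(i, j) braket (a (enum_val i)) (b (enum_val j)).

Definition spectrum (R : realType) (n : nat) (A : 'M[R[i]]_n) : set R[i] :=
  [set z | eigenvalue A z].

(* Functional calculus of a Hermitian matrix: [f] is applied to the eigenvalues
   in a unitary diagonalization of [A]. The result depends neither on the chosen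
   diagonalization nor on the values of [f] outside the spectrum of [A]; it is
   only meaningful for [A] Hermitian. *)
Definition hermfun (R : realType) (f : R -> R) (n : nat) (A : 'M[R[i]]_n) :
    'M[R[i]]_n :=
  invmx (spectralmx A)
    *m diag_mx (map_mx (fun z : R[i] => (f (complex.Re z))%:C) (spectral_diag A))
    *m spectralmx A.

(* Main.v *)
Require Import Defs.
From mathcomp Require Import all_boot all_order all_algebra.
From mathcomp Require Import sesquilinear spectral complex.
From mathcomp Require Import all_classical all_reals all_analysis.

Set Implicit Arguments.
Unset Strict Implicit.
Unset Printing Implicit Defensive.

Import Order.TTheory GRing.Theory Num.Theory.
Import numFieldNormedType.Exports.

Local Open Scope classical_set_scope.
Local Open Scope ring_scope.
Local Open Scope complex_scope.
Local Open Scope sesquilinear_scope.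

(* By unitarity of the change-of-basis matrix C, the matrix |C_xy|^2 is doubly
   stochastic, and tr[AB] = sum alpha(x) beta(y) |C_xy|^2. An order-decreasing
   function is a constant plus a nonnegative combination of indicators of
   down-sets, so it suffices to bound the sum of |C_xy|^2 over D x E by
   |D n E| for down-sets D and E. If C = LU, only the indices z in D n E
   contribute to the (D, E) minor, which therefore has rank at most |D n E|;
   being a contraction, it has squared Frobenius norm at most its rank. An
   approximation of C by products LU only costs the squared Frobenius norm of
   the error. *)

(** * Squared Frobenius norm and minors of a unitary matrix *)

Section Frobenius.
Variable C : numClosedFieldType.

Definition frob2 m n (M : 'M[C]_(m, n)) : C := \sum_i \sum_j `|M i j| ^+ 2.

Lemma frob2E m n (M : 'M[C]_(m, n)) : frob2 M = \tr (M *m M^t*).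
Proof.
by apply: eq_bigr => i _; rewrite mxE; apply: eq_bigr => j _; rewrite !mxE normCK.
Qed.

Lemma frob2_ge0 m n (M : 'M[C]_(m, n)) : 0 <= frob2 M.
Proof. by do 2!apply: sumr_ge0 => ? _; rewrite exprn_ge0. Qed.

Lemma trmxC_mul m n p (M : 'M[C]_(m, n)) (N : 'M[C]_(n, p)) :
  (M *m N)^t* = N^t* *m M^t*.
Proof. by rewrite trmx_mul map_mxM. Qed.

Lemma frob2_trC m n (M : 'M[C]_(m, n)) : frob2 (M^t*) = frob2 M.
Proof. by rewrite !frob2E trmxCK mxtrace_mulC. Qed.

Lemma frob2_unitary m r (M : 'M[C]_(r, m)) : M \is unitarymx -> frob2 M = r%:R.
Proof. by move=> /unitarymxP Mu; rewrite frob2E Mu mxtrace1. Qed.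

Lemma frob2_unitary_mull m n (V : 'M[C]_m) (M : 'M[C]_(m, n)) :
  V \is unitarymx -> frob2 (V *m M) = frob2 M.
Proof.
move=> Vu; rewrite !frob2E trmxC_mul mulmxA mxtrace_mulC !mulmxA.
by rewrite -(invmx_unitary Vu) mulVmx ?unitarymx_unit// mul1mx.
Qed.

(** Pythagoras row by row: the rows of [B] are orthonormal, so [M *m B^t* *m B] projects the rows of
    [M] orthogonally onto their span. *)
Lemma frob2_split m n r (M : 'M[C]_(m, n)) (B : 'M[C]_(r, n)) :
  B \is unitarymx -> frob2 M = frob2 (M *m B^t*) + frob2 (M - M *m B^t* *m B).
Proof.
move=> /unitarymxP Bu; set M1 := M *m B^t*.
have MM1 : M *m (M1 *m B)^t* = M1 *m M1^t*.
  by rewrite trmxC_mul mulmxA.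
have M1M : M1 *m B *m M^t* = M1 *m M1^t*.
  by rewrite /M1 trmxC_mul trmxCK -!mulmxA.
have M1M1 : M1 *m B *m (M1 *m B)^t* = M1 *m M1^t*.
  by rewrite trmxC_mul mulmxA -(mulmxA M1) Bu mulmx1.
rewrite !frob2E -mxtraceD linearB /= raddfB /= mulmxBr !mulmxBl MM1 M1M M1M1.
by rewrite subrr subr0 addrCA subrr addr0.
Qed.

(** The projection fixes [N], so [M] and [M - N] leave the same residual, whose norm is at most that
    of [M - N]. *)
Lemma frob2_le_sub m n r (M N : 'M[C]_(m, n)) (B : 'M[C]_(r, n)) :
  B \is unitarymx -> (N <= B)%MS ->
  frob2 M <= frob2 (M *m B^t*) + frob2 (M - N).
Proof.
move=> Bu /submxP[X NXB]; rewrite (frob2_split M Bu) lerD2l.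
rewrite [leRHS](frob2_split _ Bu) !mulmxBl NXB.
rewrite -(mulmxA X) (unitarymxP Bu) mulmx1.
rewrite [X in _ <= _ + X](_ : _ = frob2 (M - M *m B^t* *m B)).
  by rewrite lerDr frob2_ge0.
by rewrite opprB addrA subrK.
Qed.

(** Coordinate projection: multiplying by it on both sides cuts out a minor, padded with zeros to
    keep the size [n]. *)
Definition restr_mx n (S : {set 'I_n}) : 'M[C]_n :=
  diag_mx (\row_i (i \in S)%:R).

Lemma restr_mxE n p (S : {set 'I_n}) (M : 'M[C]_(n, p)) i j :
  (restr_mx S *m M) i j = (i \in S)%:R * M i j.
Proof. by rewrite mul_diag_mx !mxE. Qed.

Lemma mxE_restr n p (S : {set 'I_n}) (M : 'M[C]_(p, n)) i j :
  (M *m restr_mx S) i j = M i j * (j \in S)%:R.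
Proof. by rewrite mul_mx_diag !mxE. Qed.

Lemma restr_mxI n (S T : {set 'I_n}) :
  restr_mx S *m restr_mx T = restr_mx (S :&: T).
Proof.
apply/matrixP => i j; rewrite restr_mxE !mxE inE.
by case: (i \in S); rewrite ?mul1r// mul0r mul0rn.
Qed.

Lemma frob2_restr_mull n p (S : {set 'I_n}) (M : 'M[C]_(n, p)) :
  frob2 (restr_mx S *m M) <= frob2 M.
Proof.
apply: ler_sum => i _; apply: ler_sum => j _; rewrite restr_mxE.
by case: (i \in S); rewrite ?mul1r// mul0r normr0 expr0n /= exprn_ge0.
Qed.

Lemma frob2_restr n (S T : {set 'I_n}) (M : 'M[C]_n) :
  frob2 (restr_mx S *m M *m restr_mx T)
    = \sum_(i in S) \sum_(j in T) `|M i j| ^+ 2.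
Proof.
rewrite [RHS]big_mkcond; apply: eq_bigr => i _.
case: ifPn => iS; last first.
  apply: big1 => j _; rewrite mxE_restr restr_mxE (negbTE iS) !mul0r.
  by rewrite normr0 expr0n.
rewrite [RHS]big_mkcond; apply: eq_bigr => j _.
rewrite mxE_restr restr_mxE iS mul1r.
by case: (j \in T); rewrite ?mulr1// mulr0 normr0 expr0n.
Qed.

Lemma mxrank_restr_le n (S : {set 'I_n}) : (\rank (restr_mx S) <= #|S|)%N.
Proof.
rewrite /restr_mx diag_mx_sum_delta.
apply: leq_trans (_ : \sum_i (i \in S) <= _)%N; last first.
  by rewrite -sum1_card [leqRHS]big_mkcond; apply: leq_sum => i _; case: ifP.
elim/big_ind2: _ => [|M a N b Ma Nb|i _]; first by rewrite mxrank0.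
  by rewrite (leq_trans (mxrank_add _ _))// leq_add.
rewrite mxE; case: (i \in S); last by rewrite scale0r mxrank0.
by rewrite scale1r mxrank_delta.
Qed.

(* Project the rows of the minor of [V] onto the row space of that of [N]: the
   projection has squared norm at most the rank because [V] is an isometry. *)
Lemma unitary_minor_frob2_le n (V N : 'M[C]_n) (S T : {set 'I_n}) :
  V \is unitarymx ->
  frob2 (restr_mx S *m V *m restr_mx T)
    <= (\rank (restr_mx S *m N *m restr_mx T))%:R
       + frob2 (restr_mx S *m (V - N) *m restr_mx T).
Proof.
move=> Vu; set N' := restr_mx S *m N *m restr_mx T.
(* Gram-Schmidt turns a basis of the row space of [N'] into orthonormal rows, as many as the rank of
   [N']; hence [frob2 B] is that rank. *)
pose B := schmidt (row_base N').
have Bu : B \is unitarymx by rewrite schmidt_unitarymx ?rank_leq_col.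
have NB : (N' <= B)%MS by rewrite (submx_trans _ (schmidt_sub _)) ?eq_row_base.
apply: le_trans (frob2_le_sub _ Bu NB) _.
rewrite mulmxBr mulmxBl lerD2r -!mulmxA.
rewrite (le_trans (frob2_restr_mull _ _))// frob2_unitary_mull//.
by rewrite (le_trans (frob2_restr_mull _ _))// frob2_trC frob2_unitary.
Qed.

End Frobenius.

Arguments restr_mx {C n} S.

(** * Down-sets and the rearrangement inequality *)

Definition down_set (d : Order.disp_t) (P : finPOrderType d) (D : {set P}) :=
  forall x y : P, (x <= y)%O -> y \in D -> x \in D.

(* Induction on the support of [alpha], which is a down-set: subtract from
   [alpha] its least nonzero value there. *)
Lemma abel_down_set_ge0 (R : realDomainType) (d : Order.disp_t)
    (P : finPOrderType d) (c alpha : P -> R) :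
  (forall x y : P, (x <= y)%O -> alpha y <= alpha x) ->
  (forall D : {set P}, down_set D -> 0 <= \sum_(x in D) c x) ->
  \sum_x c x = 0 ->
  0 <= \sum_x c x * alpha x.
Proof.
move=> alpha_decr c_ge0 c_sum0.
have nneg (h : P -> R) : (forall x, 0 <= h x) ->
    (forall x y : P, (x <= y)%O -> h y <= h x) -> 0 <= \sum_x c x * h x.
  have [k] := ubnP #|[set x | h x != 0]%SET|.
  elim: k h => // k IHk h; rewrite ltnS => hk h_ge0 h_decr.
  set S := [set x | h x != 0]%SET in hk *.
  have [S0|[x0 x0S]] := set_0Vmem S.
    apply: sumr_ge0 => x _; have : x \notin S by rewrite S0 inE.
    by rewrite inE negbK => /eqP->; rewrite mulr0.
  have [m mS m_min] : exists2 m, m \in S & forall x, x \in S -> h m <= h x.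
    by case: (@arg_minP _ _ _ x0 (mem S) h x0S) => m; exists m.
  pose h' x := h x - h m * (x \in S)%:R.
  have h0 x : x \notin S -> h x = 0 by rewrite inE negbK => /eqP.
  have h'0 x : x \notin S -> h' x = 0.
    by move=> xS; rewrite /h' h0// (negbTE xS) mulr0 subr0.
  have h'_ge0 x : 0 <= h' x.
    have [xS|/h'0->//] := boolP (x \in S).
    by rewrite /h' xS mulr1 subr_ge0 m_min.
  have S_down (x y : P) : (x <= y)%O -> y \in S -> x \in S.
    move=> xy; rewrite !inE => hy; rewrite gt_eqF//.
    by rewrite (lt_le_trans _ (h_decr _ _ xy))// lt_def hy h_ge0.
  rewrite (eq_bigr (fun x => c x * h' x + h m * (c x * (x \in S)%:R))).
    rewrite big_split /= addr_ge0//.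
      apply: IHk => // [|x y xy].
        apply: leq_trans hk; apply: proper_card; apply/properP; split.
          apply/fintype.subsetP => x; rewrite inE; apply: contraR => /h'0 ->.
          by rewrite eqxx.
        by exists m => //; rewrite inE /h' mS mulr1 subrr eqxx.
      have [yS|/h'0->//] := boolP (y \in S).
      by rewrite /h' yS (S_down _ _ xy yS) lerD2r h_decr.
    rewrite -mulr_sumr mulr_ge0//.
    rewrite (eq_bigr (fun x => if x \in S then c x else 0)).
      by rewrite -big_mkcond c_ge0.
    by move=> x _; case: (x \in S); rewrite ?mulr1 ?mulr0.
  by move=> x _; rewrite /h' mulrCA -mulrDr subrK.
(* Since [c] sums to zero, subtracting the minimum of [alpha] leaves the sum unchanged and makes the
   function nonnegative. *)
case: (pickP (fun _ : P => true)) => [x0 _|P0]; last by rewrite big_pred0.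
case: (@arg_minP _ _ _ x0 xpredT alpha isT) => m _ m_min.
have := nneg (fun x => alpha x - alpha m); rewrite /=.
under eq_bigr do rewrite mulrBr.
rewrite sumrB -mulr_suml c_sum0 mul0r subr0; apply => [x|x y xy].
  by rewrite subr_ge0 m_min.
by rewrite lerD2r alpha_decr.
Qed.

(** Abel summation is applied twice, first to [alpha] and then, for each down-set [D], to [beta];
    the unit column and row sums of [w] make the respective coefficients sum to zero. *)
Lemma down_set_rearrangement (R : realDomainType) (d : Order.disp_t)
    (P : finPOrderType d) (w : P -> P -> R) (alpha beta : P -> R) :
  (forall x y : P, (x <= y)%O -> alpha y <= alpha x) ->
  (forall x y : P, (x <= y)%O -> beta y <= beta x) ->
  (forall x, \sum_y w x y = 1) -> (forall y, \sum_x w x y = 1) ->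
  (forall D E : {set P}, down_set D -> down_set E ->
    \sum_(x in D) \sum_(y in E) w x y <= #|D :&: E|%:R) ->
  \sum_x \sum_y alpha x * beta y * w x y <= \sum_x alpha x * beta x.
Proof.
move=> alpha_decr beta_decr w_row w_col w_down.
rewrite -subr_ge0 -sumrB.
rewrite (eq_bigr (fun x => (beta x - \sum_y w x y * beta y) * alpha x)).
  apply: abel_down_set_ge0 => // [D D_down|]; last first.
    rewrite sumrB exchange_big /=.
    under [X in _ - X]eq_bigr do rewrite -mulr_suml w_col mul1r.
    by rewrite subrr.
  rewrite sumrB exchange_big /= big_mkcond -sumrB /=.
  rewrite (eq_bigr (fun y => ((y \in D)%:R - \sum_(x in D) w x y) * beta y)).
    apply: abel_down_set_ge0 => // [E E_down|]; rewrite sumrB.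
      rewrite exchange_big /= subr_ge0 (le_trans (w_down _ _ D_down E_down))//.
      rewrite -sum1_card natr_sum.
      rewrite (eq_bigl (fun y => (y \in E) && (y \in D))); last first.
        by move=> y; rewrite inE andbC.
      by rewrite big_mkcondr; apply: ler_sum => y _; case: ifP.
    rewrite exchange_big /=.
    under [X in _ - X]eq_bigr do rewrite w_row.
    by rewrite [X in _ - X]big_mkcond -sumrB big1// => x _; case: ifP;
      rewrite subrr.
  move=> y _; rewrite mulrBl mulr_suml; case: (y \in D); by rewrite ?mul1r ?mul0r.
move=> x _; rewrite mulrBl mulr_suml (mulrC (alpha x)); congr (_ - _).
by apply: eq_bigr => y _; rewrite mulrC (mulrC (alpha x)) mulrA.
Qed.

(** * Down-set minors of products [L *m U] and of their limits *)

Section DownSets.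
Context (R : realType) (d : Order.disp_t) (P : finPOrderType d).
Implicit Types D E : {set P}.

Lemma mem_enum_rank D x : (enum_rank x \in enum_rank @: D) = (x \in D).
Proof. by rewrite (mem_imset _ _ enum_rank_inj). Qed.

(** A row of [L] indexed in the down-set [D] is supported below its index, hence inside [D]. *)
Lemma lower_mx_restr D (L : 'M[R[i]]_#|P|) : down_set D -> lower_mx L ->
  restr_mx (enum_rank @: D) *m L
    = restr_mx (enum_rank @: D) *m L *m restr_mx (enum_rank @: D).
Proof.
move=> D_down Llow; apply/matrixP => i j.
rewrite mxE_restr restr_mxE -(enum_valK i) -(enum_valK j) !mem_enum_rank.
have [iD|_] := boolP (enum_val i \in D); last by rewrite !mul0r.
have [_|jD] := boolP (enum_val j \in D); first by rewrite mulr1.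
by rewrite mulr0 Llow ?mulr0//; apply: contra jD => /D_down; apply.
Qed.

Lemma upper_mx_restr E (U : 'M[R[i]]_#|P|) : down_set E -> upper_mx U ->
  U *m restr_mx (enum_rank @: E)
    = restr_mx (enum_rank @: E) *m (U *m restr_mx (enum_rank @: E)).
Proof.
move=> E_down Uup; apply/matrixP => i j.
rewrite restr_mxE mxE_restr -(enum_valK i) -(enum_valK j) !mem_enum_rank.
have [jE|_] := boolP (enum_val j \in E); last by rewrite !mulr0.
have [_|iE] := boolP (enum_val i \in E); first by rewrite mul1r.
by rewrite mul0r Uup ?mul0r//; apply: contra iE => /E_down; apply.
Qed.

(** The two restrictions that meet between [L] and [U] merge into the one to [D :&: E], through
    which the whole minor factors. *)
Lemma mxrank_lower_upper_minor D E (N : 'M[R[i]]_#|P|) :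
  down_set D -> down_set E -> lower_upper_mx N ->
  (\rank (restr_mx (enum_rank @: D) *m N *m restr_mx (enum_rank @: E))
    <= #|D :&: E|)%N.
Proof.
move=> D_down E_down [L Llow [U Uup <-]].
rewrite mulmxA -mulmxA (lower_mx_restr D_down Llow) (upper_mx_restr E_down Uup).
rewrite -(mulmxA (_ *m L)) (mulmxA (restr_mx _) (restr_mx _)) restr_mxI.
rewrite (leq_trans (mxrankM_maxr _ _))// (leq_trans (mxrankM_maxl _ _))//.
rewrite (leq_trans (mxrank_restr_le _ _))// -imsetI ?card_imset//;
  by [apply: enum_rank_inj | move=> ? ? _ _; apply: enum_rank_inj].
Qed.

(** Squared modulus with values in [R]: the rearrangement inequality needs weights in a totally
    ordered ring, while the norm of [z] lies in [R[i]]. *)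
Definition normc2 (z : R[i]) : R := complex.Re z ^+ 2 + complex.Im z ^+ 2.

Lemma normc2E (z : R[i]) : `|z| ^+ 2 = (normc2 z)%:C.
Proof. by rewrite add_Re2_Im2. Qed.

Lemma closure_minor_le D E (V : 'M[R[i]]_#|P|) :
  down_set D -> down_set E -> V \is unitarymx ->
  closure (@lower_upper_mx R d P) V ->
  \sum_(x in D) \sum_(y in E) normc2 (V (enum_rank x) (enum_rank y))
    <= #|D :&: E|%:R.
Proof.
move=> D_down E_down Vu Vcl; apply/ler_addgt0Pr => e e_gt0.
set n := #|P| in V Vu Vcl *.
(* The error has at most [n * n] entries, each of squared modulus at most [eps ^+ 2]. The [+ 1]
   keeps [K] positive for empty [P], and the cap at 1 gives [eps ^+ 2 <= eps <= e / K]. *)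
pose K : R := (n * n)%:R + 1.
have K_gt0 : 0 < K by rewrite ltr_wpDl.
pose eps := Num.min 1 (e / K).
have eps_gt0 : 0 < eps by rewrite lt_min ltr01 divr_gt0.
have epsC_gt0 : 0 < eps%:C :> R[i] by rewrite ltcR.
have [N [NLU [_ VN]]] := Vcl _ (nbhsx_ballx V _ epsC_gt0).
have {}VN i j : `|(V - N) i j| ^+ 2 <= (eps ^+ 2)%:C.
  rewrite rmorphXn !mxE lerXn2r ?nnegrE ?normr_ge0 ?(ltW epsC_gt0)//.
  exact: (ltW (VN i j)).
have /= := unitary_minor_frob2_le N (enum_rank @: D) (enum_rank @: E) Vu.
rewrite !frob2_restr.
have sumE (M : 'M[R[i]]_n) : \sum_(i in enum_rank @: D)
    \sum_(j in enum_rank @: E) `|M i j| ^+ 2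
    = (\sum_(x in D) \sum_(y in E) normc2 (M (enum_rank x) (enum_rank y)))%:C.
  rewrite big_imset /=; last by move=> ? ? _ _; apply: enum_rank_inj.
  rewrite rmorph_sum; apply: eq_bigr => x _.
  rewrite big_imset /=; last by move=> ? ? _ _; apply: enum_rank_inj.
  by rewrite rmorph_sum; apply: eq_bigr => y _; rewrite normc2E.
rewrite sumE => /le_trans le_minor; rewrite -lecR; apply: le_minor.
rewrite rmorphD rmorph_nat lerD//.
  by rewrite ler_nat mxrank_lower_upper_minor.
apply: (@le_trans _ _ (\sum_(i < n) \sum_(j < n) (eps ^+ 2)%:C)).
  rewrite big_mkcond; apply: ler_sum => i _; case: ifP => _; last first.
    by apply: sumr_ge0 => j _; rewrite ler0c sqr_ge0.
  rewrite big_mkcond; apply: ler_sum => j _; case: ifP => _; last first.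
    by rewrite ler0c sqr_ge0.
  exact: VN.
under eq_bigr do rewrite sumr_const card_ord.
rewrite sumr_const card_ord -mulrnA -mulr_natl -(rmorph_nat (real_complex R)).
rewrite -rmorphM lecR.
have : eps ^+ 2 <= e / K.
  rewrite expr2 (le_trans (ler_piMr (ltW eps_gt0) _))// ge_min ?lexx ?orbT//.
move=> /(ler_wpM2l (ltW K_gt0)); rewrite (mulrCA K e) divff ?gt_eqF// mulr1.
by apply: le_trans; rewrite ler_wpM2r ?sqr_ge0// lerDl.
Qed.

End DownSets.

(** * Spectral decompositions and functional calculus *)

Section SpectralDecomposition.
Context (R : realType) (P : finType).
Implicit Types (a b : P -> 'cV[R[i]]_#|P|) (c : P -> R).

(** For an orthonormal basis, the unitary matrix that diagonalizes every combination of the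
    [ketbra (a i)]. *)
Definition bra_mx a : 'M[R[i]]_#|P| := \matrix_i (a (enum_val i))^t*.

Definition real_diag_mx c : 'M[R[i]]_#|P| :=
  diag_mx (\row_i (c (enum_val i))%:C).

Lemma change_of_basisE a b : change_of_basis a b = bra_mx a *m (bra_mx b)^t*.
Proof.
apply/matrixP => i j; rewrite !mxE /braket !mxE; apply: eq_bigr => k _.
by rewrite !mxE conjCK.
Qed.

Lemma bra_mx_unitary a : orthonormal_basis a -> bra_mx a \is unitarymx.
Proof.
move=> a_basis; apply/unitarymxP; rewrite -change_of_basisE.
by apply/matrixP => i j; rewrite !mxE a_basis (inj_eq enum_val_inj).
Qed.

Lemma sum_ketbraE a c :
  \sum_i (c i)%:C *: ketbra (a i) = (bra_mx a)^t* *m real_diag_mx c *m bra_mx a.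
Proof.
apply/matrixP => i j; rewrite summxE mul_mx_diag !mxE.
rewrite (reindex (@enum_val P xpredT)) /=; last by apply/onW_bij/enum_val_bij.
apply: eq_bigr => k _; rewrite !mxE big_ord1 !mxE conjCK.
by rewrite mulrCA mulrA.
Qed.

(** Two diagonalizations of [A] are intertwined by the matrix [W], whose nonzero entries link equal
    eigenvalues only; so [W] still intertwines them after [f] is applied. *)
Lemma hermfun_sum_ketbra (f : R -> R) a c (A : 'M[R[i]]_#|P|) :
  A \is hermsymmx -> orthonormal_basis a ->
  A = \sum_i (c i)%:C *: ketbra (a i) ->
  hermfun f A = \sum_i (f (c i))%:C *: ketbra (a i).
Proof.
move=> /hermitian_normalmx/orthomx_spectralP A_diag /bra_mx_unitary aU.
rewrite !sum_ketbraE => A_bra; rewrite /hermfun.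
have Sunit := spectral_unit A.
set S := spectralmx A in A_diag Sunit *; set s := spectral_diag A in A_diag *.
set V := bra_mx a in aU A_bra *.
have VV : V *m V^t* = 1%:M by apply/unitarymxP.
have VV' : V^t* *m V = 1%:M by apply: mulmx1C.
pose W := S *m V^t*.
have sW : diag_mx s *m W = W *m real_diag_mx c.
  (* On the left [A] is expanded in one diagonalization, on the right in the other. *)
  have : S *m A *m V^t* = S *m A *m V^t* by [].
  rewrite {1}A_diag {1}A_bra !mulmxA mulmxV// mul1mx -!mulmxA VV mulmx1.
  by rewrite mulmxA.
have fW : diag_mx (map_mx (fun z => (f (complex.Re z))%:C) s) *m W
    = W *m real_diag_mx (f \o c).
  move: W sW => W /matrixP sW; apply/matrixP => i j; have := sW i j.
  rewrite !mul_diag_mx !mul_mx_diag !mxE /= (mulrC (s 0 i)).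
  (* A nonzero [W i j] cancels, which makes [s 0 i] the real number [c (enum_val j)]. *)
  have [->|W0] := eqVneq (W i j) 0; first by rewrite mulr0 !mul0r.
  by move=> /(mulfI W0) ->; rewrite mulrC.
rewrite -[LHS]mulmx1 -VV' -!mulmxA (mulmxA S) -/W (mulmxA _ W) fW.
by rewrite !mulmxA mulVmx// mul1mx.
Qed.

(** The bra of [a x] is a left eigenvector, nonzero as a row of a unitary matrix. *)
Lemma spectrum_sum_ketbra a c x : orthonormal_basis a ->
  spectrum (\sum_i (c i)%:C *: ketbra (a i)) (c x)%:C.
Proof.
move=> /bra_mx_unitary/unitarymxP VV; rewrite sum_ketbraE.
set V := bra_mx a in VV *; apply/eigenvalueP.
exists (row (enum_rank x) V).
  rewrite -row_mul !mulmxA VV mul1mx; apply/rowP => j.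
  by rewrite mxE mul_diag_mx !mxE enum_rankK.
apply/eqP => V0.
have /rowP/(_ (enum_rank x)) : row (enum_rank x) (1%:M : 'M[R[i]]_#|P|) = 0.
  by rewrite -VV row_mul V0 mul0mx.
by rewrite !mxE eqxx => /eqP; rewrite oner_eq0.
Qed.

(** By cyclicity the trace is that of [D *m V *m E *m V^t*], with [V] the change of basis and [D],
    [E] the diagonal matrices of [c] and [e]. *)
Lemma mxtrace_sum_ketbra a b c e :
  \tr ((\sum_i (c i)%:C *: ketbra (a i)) *m (\sum_j (e j)%:C *: ketbra (b j)))
  = (\sum_x \sum_y c x * e y
      * normc2 (change_of_basis a b (enum_rank x) (enum_rank y)))%:C.
Proof.
rewrite !sum_ketbraE -!mulmxA mxtrace_mulC -!mulmxA.
set V := change_of_basis a b.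
have -> : bra_mx b *m (bra_mx a)^t* = V^t*.
  by rewrite /V change_of_basisE trmxC_mul trmxCK.
rewrite (mulmxA (bra_mx a)) -change_of_basisE -/V.
rewrite /mxtrace (reindex (@enum_rank P)) /=; last exact/onW_bij/enum_rank_bij.
rewrite rmorph_sum; apply: eq_bigr => x _; rewrite rmorph_sum.
rewrite mul_diag_mx !mxE (reindex (@enum_rank P)) /=; last first.
  exact/onW_bij/enum_rank_bij.
rewrite mulr_sumr; apply: eq_bigr => y _.
rewrite mul_diag_mx !mxE !enum_rankK !rmorphM /= -normc2E normCK.
by rewrite -mulrA (mulrCA (braket _ _)).
Qed.

End SpectralDecomposition.

(** * The trace inequality *)

Lemma mxtrace_closure_lower_upper_le (R : realType) (d : Order.disp_t)
    (P : finPOrderType d) (alpha beta : P -> R) (a b : P -> 'cV[R[i]]_#|P|) :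
  order_decreasing alpha -> order_decreasing beta ->
  orthonormal_basis a -> orthonormal_basis b ->
  closure (@lower_upper_mx R d P) (change_of_basis a b) ->
  \tr ((\sum_i (alpha i)%:C *: ketbra (a i))
        *m (\sum_j (beta j)%:C *: ketbra (b j)))
    <= (\sum_x alpha x * beta x)%:C.
Proof.
move=> alpha_decr beta_decr a_basis b_basis V_cl.
rewrite mxtrace_sum_ketbra lecR; set V := change_of_basis a b in V_cl *.
have Vu : V \is unitarymx.
  rewrite /V change_of_basisE mul_unitarymx ?trmxC_unitary//;
  exact: bra_mx_unitary.
have row1 (M : 'M[R[i]]_#|P|) x : M \is unitarymx ->
    \sum_y normc2 (M (enum_rank x) (enum_rank y)) = 1.
  move=> /unitarymxP/matrixP/(_ (enum_rank x) (enum_rank x)).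
  rewrite !mxE eqxx (reindex (@enum_rank P)) /=; last exact/onW_bij/enum_rank_bij.
  move=> M1; apply: complexI; rewrite rmorph_sum /= -[RHS]M1.
  by apply: eq_bigr => y _; rewrite -normc2E normCK !mxE.
apply: (down_set_rearrangement alpha_decr beta_decr) => [x|y|D E D_down E_down].
- exact: row1.
(* Column sums are row sums of the transpose, which is unitary too. *)
- have := row1 V^T y; rewrite trmx_unitary => /(_ Vu) <-.
  by apply: eq_bigr => x _; rewrite [V^T _ _]mxE.
- exact: closure_minor_le.
Qed.

(* The order on [R[i]] relates numbers with equal imaginary parts only, so the
   conclusions include that the traces are real. *)
Theorem corollary1 (R : realType) (d : Order.disp_t) (P : finPOrderType d)
    (alpha beta : P -> R)
    (A B : 'M[R[i]]_#|P|)
    (a b : P -> 'cV[R[i]]_#|P|)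
    (alpha_decr : order_decreasing alpha)
    (beta_decr : order_decreasing beta)
    (A_herm : A \is hermsymmx)
    (B_herm : B \is hermsymmx)
    (a_basis : orthonormal_basis a)
    (b_basis : orthonormal_basis b)
    (A_spec : A = \sum_(i : P) (alpha i)%:C *: ketbra (a i))
    (B_spec : B = \sum_(j : P) (beta j)%:C *: ketbra (b j))
    (C_closure : closure (@lower_upper_mx R d P) (change_of_basis a b)) :
  \tr (A *m B) <= (\sum_(x : P) alpha x * beta x)%:C
  /\
  (forall (I : interval R) (f g : R -> R),
     spectrum A `<=` [set r%:C | r in [set` I]] ->
     spectrum B `<=` [set r%:C | r in [set` I]] ->
     {in I &, {homo f : x y / x <= y}} ->
     {in I &, {homo g : x y / x <= y}} ->
     \tr (hermfun f A *m hermfun g B)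
       <= (\sum_(x : P) f (alpha x) * g (beta x))%:C).
Proof.
rewrite {1}A_spec {1}B_spec.
split=> [|I f g sA sB f_homo g_homo].
  exact: mxtrace_closure_lower_upper_le.
(* Every [alpha x] is an eigenvalue of [A], hence lies in [I], where [f] is monotone; this makes
   [f \o alpha] order-decreasing again. *)
have alphaI x : alpha x \in I.
  have := spectrum_sum_ketbra alpha x a_basis.
  by rewrite -A_spec => /sA[r rI /complexI<-].
have betaI x : beta x \in I.
  have := spectrum_sum_ketbra beta x b_basis.
  by rewrite -B_spec => /sB[r rI /complexI<-].
rewrite (hermfun_sum_ketbra f A_herm a_basis A_spec).
rewrite (hermfun_sum_ketbra g B_herm b_basis B_spec).
apply: mxtrace_closure_lower_upper_le => // x y xy.
  by apply: f_homo => //; apply: alpha_decr.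
by apply: g_homo => //; apply: beta_decr.
Qed.
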